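(* For any Banach space $Y$ the following statements are equivalent: (a) each linear continuous surjection $L:Z\to Y$ from a Banach space $Z$ is $\mathcal F_c(Z)$-hereditary invertible with respect to the family $\mathcal F_c(Z)$ of all convex closed subsets of $Z$; (b) each linear continuous surjection $L:Z\to Y$ from a Banach space $Z$ is $\mathcal C_c$-hereditary invertible with respect to the family $\mathcal C_c$ of all convex compact subsets of $Z$; (c) $\dim Y=1$.
   Context: Banach spaces are over $\mathbb R$. For a family $\mathcal C$ of subsets of a Banach space $Z$, a linear continuous mapping $L:Z\to Y$ between Banach spaces is called $\mathcal C$-hereditary invertible if for every $C\in\mathcal C$ the restriction $L|_C:C\to L(C)$ admits a right-inverse continuous mapping $s:L(C)\to C$, i.e. $L|_C\circ s=\mathrm{id}|_{L(C)}$.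
   Formalization: The Banach space Y is assumed to be nonzero: for Y = {0} statements (a) and (b) hold trivially (L(C) is empty or a single point) while dim Y = 0, so the equivalence as stated fails there. *)

(* Defs.v *)
From HB Require Import structures.
From mathcomp Require Import all_boot all_order all_algebra.
From mathcomp Require Import all_classical all_reals all_analysis.

Set Implicit Arguments.
Unset Strict Implicit.
Unset Printing Implicit Defensive.

Import Order.TTheory GRing.Theory Num.Theory.
Import numFieldNormedType.Exports.

Local Open Scope classical_set_scope.
Local Open Scope ring_scope.

Definition closed_convex_sets (R : realType) (Z : completeNormedModType R) :
    set (set Z) :=
  [set C | closed C /\ convex_set C].

Definition compact_convex_sets (R : realType) (Z : completeNormedModType R) :
    set (set Z) :=
  [set C | compact C /\ convex_set C].

(* A map s : L(C) -> C is represented by a total function Y -> Z of which only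
   the values on L @` C matter; {within L @` C, continuous s} is continuity for
   the subspace topology on L @` C. *)
Definition hereditary_invertible (R : realType)
    (Z Y : completeNormedModType R) (CC : set (set Z)) (L : {linear Z -> Y}) :
    Prop :=
  forall C : set Z, CC C ->
    exists s : Y -> Z,
      [/\ set_fun (L @` C) C s,
          {within L @` C, continuous s} &
          {in L @` C, cancel s L}].

Definition is_basis (R : realType) (V : lmodType R) (n : nat)
    (e : 'I_n -> V) : Prop :=
  (forall c : 'I_n -> R, \sum_(i < n) c i *: e i = 0 -> forall i, c i = 0) /\
  (forall v : V, exists c : 'I_n -> R, v = \sum_(i < n) c i *: e i).

(* \dim of vector.v is only available on types that already carry a vectType
   structure, i.e. on spaces known in advance to be finite-dimensional. *)
Definition has_dim (R : realType) (n : nat) (V : lmodType R) : Prop :=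
  exists e : 'I_n -> V, is_basis e.

(* Main.v *)
Require Import Defs.
From HB Require Import structures.
From mathcomp Require Import all_boot all_order all_algebra.
From mathcomp Require Import all_classical all_reals all_analysis.
From mathcomp Require Import lra.

Set Implicit Arguments.
Unset Strict Implicit.
Unset Printing Implicit Defensive.

Import Order.TTheory GRing.Theory Num.Theory.
Import numFieldNormedType.Exports.

Local Open Scope classical_set_scope.
Local Open Scope ring_scope.

(** Two observations carry the equivalence.

    If Y is one-dimensional, L is a linear functional f up to a coordinate, and
    f @` C is an interval for C convex. A continuous section over it can be
    drawn as a polygonal line: take vertices c_0, c_1, ... in C whose values
    f c_n do not decrease and are cofinal in f @` C, and join consecutive
    vertices by segments, which stay in C. Every t in f @` C has a neighbourhood
    in f @` C on which only finitely many segments matter, so the line is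
    continuous ([half_selection]); doing the same towards the left, i.e. for
    - f, gives [interval_selection].

    In dimension two a compact convex set can twist over a curved boundary.
    Consider the parabola y = x^2, all of whose points are extreme points of
    its convex hull. In R^3 the [twisted_wedge] is a compact convex set lying
    over a part of this hull such that the fibre over (t, t^2) is the single
    height 1 for 0 < t <= 1 and the single height 0 for -1 <= t < 0. A section
    along the parabola is therefore forced to jump at 0. If Y contains two independent
    vectors e1, e2, the wedge embeds in Y * R above the plane they span, and
    the projection of Y * R onto Y has no continuous section over it
    ([projection_not_hereditary]). Hence, if compact convex sets always admit
    sections, every vector of Y is a multiple of a given nonzero one. The
    passage from closed to compact convex sets is just that compact sets are
    closed. *)

(** * Convex sets and continuity *)

Lemma convex_set_segmentP (R : realType) (Z : lmodType R) (C : set Z) :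
  convex_set C <->
  forall a b (t : R), 0 <= t -> t <= 1 -> C a -> C b -> C (a + t *: (b - a)).
Proof.
split=> [cC a b t t0 t1 Ca Cb|cC a b l /set_mem Ca /set_mem Cb].
  have /set_mem := cC b a (Itv01 t0 t1) (mem_set Cb) (mem_set Ca).
  suff -> : conv (Itv01 t0 t1) (b : convex_lmodType Z) a = a + t *: (b - a) by [].
  by rewrite scalerBr addrCA -{2}[a]scale1r -scalerBl.
apply/mem_set.
suff -> : conv l a b = b + l%:num *: (a - b) by apply: cC.
by rewrite scalerBr addrCA -{2}[b]scale1r -scalerBl.
Qed.

Lemma linear_image_convex (R : realType) (U V : lmodType R) (f : {linear U -> V})
    (K : set U) : convex_set K -> convex_set (f @` K).
Proof.
move=> /convex_set_segmentP cK.
apply/convex_set_segmentP => _ _ t t0 t1 [a Ka <-] [b Kb <-].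
by exists (a + t *: (b - a)); [exact: cK|rewrite linearD linearZ linearB].
Qed.

Lemma within_continuousT_comp (T U V : topologicalType) (A : set T) (B : set U)
    (f : T -> U) (g : U -> V) :
  continuous f -> f @` A `<=` B -> {within B, continuous g} ->
  {within A, continuous (g \o f)}.
Proof.
move=> cf fAB /subspace_continuousP cg; apply/subspace_continuousP => x Ax.
have /cg cgfx : B (f x) by apply: fAB; exists x.
apply: (cvg_comp _ _ _ cgfx) => P.
rewrite /within /= !nbhs_simpl/= => /cf; rewrite nbhs_simpl/=.
by apply: filterS => z /= PBz Az; apply: PBz; apply: fAB; exists z.
Qed.

(** * Polygonal sections over an interval *)

Section CofinalSequence.
Variables (R : realType) (T : Type) (f : T -> R) (C : set T) (c0 : T).
Hypothesis Cc0 : C c0.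

(** Cofinality of a countable set of values rests on the density of the
    rationals: when f has no maximum on C, a point of C above each rational
    that f reaches or exceeds on C is enough. Taking running maxima then makes the
    values increase, and the sequence is allowed to pause only by repeating
    the very same point, so that no segment joins distinct points of one
    fibre. *)
Lemma cofinal_sequence : exists c : nat -> T,
  [/\ c 0%N = c0, forall n, C (c n),
      forall n, c n.+1 = c n \/ f (c n) < f (c n.+1) &
      forall x, C x -> exists n, f x <= f (c n)].
Proof.
have [d [Cd dcof]] : exists d : nat -> T,
    (forall n, C (d n)) /\ forall x, C x -> exists n, f x <= f (d n).
  have [[m Cm mmax]|nomax] :=
      pselect (exists2 m, C m & forall x, C x -> f x <= f m).
    by exists (fun=> m); split=> // x Cx; exists 0%N; apply: mmax.
  pose P (q : rat) (x : T) := C x /\ ratr q <= f x.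
  have /choice[d dP] : forall n : nat, exists x, C x /\
      forall q y, unpickle n = Some q -> P q y -> P q x.
    move=> n; case: (unpickle n) => [q|]; last by exists c0.
    have [[x Px]|nP] := pselect (exists x, P q x).
      by exists x; split=> [|_ _ [<-] //]; case: Px.
    by exists c0; split=> // _ y [<-] Py; case: nP; exists y.
  exists d; split=> [n|x Cx]; first by case: (dP n).
  have [y Cy fxy] : exists2 y, C y & f x < f y.
    apply: contrapT => ny; apply: nomax; exists x => // y Cy.
    by rewrite leNgt; apply/negP => fxy; apply: ny; exists y.
  have [q] := rat_in_itvoo fxy; rewrite in_itv/= => /andP[xq qy].
  exists (pickle q); apply: (le_trans (ltW xq)).
  have [_ /(_ q y (pickleK q))[]//] := dP (pickle q).
  by split=> //; apply: ltW.
pose c := fix c n := if n is m.+1 then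
  if f (c m) < f (d m) then d m else c m else c0.
exists c; split=> //.
- by elim=> //= n IH; case: ifP.
- by move=> n /=; case: ifP; [right|left].
- move=> x /dcof[n xn]; exists n.+1 => /=.
  by case: ltP => // dc; apply: (le_trans xn).
Qed.

End CofinalSequence.

(** When a = b the quotient is 0 by convention, and so is the ramp. *)
Definition ramp (R : realType) (a b t : R) : R :=
  Num.min 1 (Num.max 0 ((t - a) / (b - a))).

Section Ramp.
Variable R : realType.
Implicit Types a b t : R.

Lemma ramp_ge0 a b t : 0 <= ramp a b t.
Proof. by rewrite /ramp le_min ler01 le_max lexx. Qed.

Lemma ramp_le1 a b t : ramp a b t <= 1.
Proof. by rewrite /ramp ge_min lexx. Qed.

Lemma ramp_eq0 a b t : a <= b -> t <= a -> ramp a b t = 0.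
Proof.
move=> ab ta; rewrite /ramp (max_idPl _) ?(min_idPr _) ?ler01//.
by rewrite mulr_le0_ge0 ?subr_le0// invr_ge0 subr_ge0.
Qed.

Lemma ramp_eq1 a b t : a < b -> b <= t -> ramp a b t = 1.
Proof.
move=> ab bt; rewrite /ramp (min_idPl _)// le_max ler_pdivlMr ?subr_gt0//.
by rewrite mul1r lerB// orbT.
Qed.

Lemma ramp_inside a b t : a < b -> a <= t -> t <= b ->
  ramp a b t * (b - a) = t - a.
Proof.
move=> ab at_ tb; rewrite /ramp (max_idPr _) ?(min_idPr _).
- by rewrite divfK// subr_eq0 gt_eqF.
- by rewrite ler_pdivrMr ?subr_gt0// mul1r lerB.
- by rewrite divr_ge0 ?subr_ge0// ltW.
Qed.

Lemma continuous_ramp a b : continuous (ramp a b : R^o -> R^o).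
Proof.
move=> t.
have lin : {for t, continuous ((fun u => (u - a) / (b - a)) : R^o -> R^o)}.
  by apply: cvgMr_tmp; apply: cvgB; [exact: cvg_id|exact: cvg_cst].
have cst r : {for t, continuous ((fun=> r) : R^o -> R^o)} by exact: cvg_cst.
exact: continuous_min (cst 1) (continuous_max (cst 0) lin).
Qed.

End Ramp.

Section PolygonalLine.
Variables (R : realType) (Z : normedModType R) (C : set Z).
Variables (f : {linear Z -> R^o}) (c : nat -> Z).
Hypothesis convC : convex_set C.
Hypothesis Cc : forall n, C (c n).
Hypothesis c_incr : forall n, c n.+1 = c n \/ f (c n) < f (c n.+1).

(** Summing the increments of all segments, each weighted by its own ramp,
    makes continuity immediate; the case distinction on which segment t falls
    in is recovered in the lemmas below. *)
Fixpoint polygonal n (t : R) : Z := if n is m.+1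
  then polygonal m t + ramp (f (c m)) (f (c m.+1)) t *: (c m.+1 - c m)
  else c 0%N.

Lemma vertex_nondecreasing n m : (n <= m)%N -> f (c n) <= f (c m).
Proof.
elim: m => [|m IH]; first by rewrite leqn0 => /eqP->.
rewrite leq_eqVlt => /predU1P[->//|/IH/le_trans]; apply.
by case: (c_incr m) => [->//|/ltW].
Qed.

Lemma continuous_polygonal n : continuous (polygonal n).
Proof.
elim: n => [|n IH] t; first exact: cvg_cst.
apply: cvgD; first exact: IH.
apply: cvgZ; first exact: continuous_ramp.
exact: cvg_cst.
Qed.

Lemma polygonal_start n t : t <= f (c 0%N) -> polygonal n t = c 0%N.
Proof.
move=> t0; elim: n => //= n ->.
rewrite ramp_eq0 ?scale0r ?addr0 ?(vertex_nondecreasing (leqnSn _))//.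
exact: (le_trans t0 (vertex_nondecreasing (leq0n _))).
Qed.

Lemma polygonal_end n t : f (c n) <= t -> polygonal n t = c n.
Proof.
elim: n => //= n IH nt.
rewrite IH; last exact: le_trans (vertex_nondecreasing (leqnSn n)) nt.
have [->|lt] := c_incr n; first by rewrite subrr scaler0 addr0.
by rewrite ramp_eq1// scale1r addrC subrK.
Qed.

(** Later segments have a ramp that vanishes up to their starting value, so
    the partial sums are locally stationary. *)
Lemma polygonal_stable n m t : t <= f (c n) -> (n <= m)%N ->
  polygonal m t = polygonal n t.
Proof.
move=> tn; elim: m => [|m IH]; first by rewrite leqn0 => /eqP->.
rewrite leq_eqVlt => /predU1P[->//|nm] /=.
rewrite (IH nm) ramp_eq0 ?scale0r ?addr0 ?(vertex_nondecreasing (leqnSn _))//.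
exact: (le_trans tn (@vertex_nondecreasing n m nm)).
Qed.

Lemma polygonal_in n t : C (polygonal n t).
Proof.
elim: n => //= n IH; have [tn|/ltW nt] := leP t (f (c n)).
  by rewrite ramp_eq0 ?scale0r ?addr0 ?(vertex_nondecreasing (leqnSn _)).
rewrite polygonal_end//; move/convex_set_segmentP: convC; apply=> //.
  exact: ramp_ge0.
exact: ramp_le1.
Qed.

Lemma polygonalK n t : f (c 0%N) <= t -> t <= f (c n) ->
  f (polygonal n t) = t.
Proof.
move=> t0; elim: n => [tn|n IH tn] /=; first by apply/le_anti; rewrite t0.
have [tn'|/ltW nt] := leP t (f (c n)).
  by rewrite ramp_eq0 ?scale0r ?addr0 ?(vertex_nondecreasing (leqnSn _))// IH.
rewrite polygonal_end//; have [cE|lt] := c_incr n.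
  by rewrite cE subrr scaler0 addr0; apply/le_anti; rewrite nt -cE tn.
by rewrite linearD linearZ linearB/= [X in _ + X]ramp_inside// addrC subrK.
Qed.

End PolygonalLine.

(** The infinite polygonal line starting at c0: near a point t of f @` C it
    agrees with one of its finite stages. If t is exceeded by some vertex value
    this holds on a neighbourhood of t; otherwise t is the maximum of f @` C
    and is a vertex value, and one stage serves all of f @` C. *)
Lemma half_selection (R : realType) (Z : normedModType R) (C : set Z)
    (f : {linear Z -> R^o}) (c0 : Z) : convex_set C -> C c0 ->
  exists g : R -> Z,
    [/\ {within f @` C, continuous g},
        forall t, C (g t),
        forall t, t <= f c0 -> g t = c0 &
        forall t, (f @` C) t -> f c0 <= t -> f (g t) = t].
Proof.
move=> convC Cc0.
have [c [c0E Cc cincr ccof]] := cofinal_sequence f Cc0.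
have /choice[N NP] : forall t : R, exists n,
    (f @` C) t -> t <= f (c n).
  move=> t; have [[x Cx <-]|nt] := pselect ((f @` C) t); last by exists 0%N.
  by have [n] := ccof x Cx; exists n.
have gE t n : (f @` C) t -> t <= f (c n) ->
    polygonal f c (N t) t = polygonal f c n t.
  move=> /NP tN tn; have [nN|/ltnW Nn] := leqP n (N t).
    exact: polygonal_stable.
  by apply/esym/polygonal_stable.
exists (fun t => polygonal f c (N t) t); split.
- apply/subspace_continuousP => t It.
  have [n tn near_n] : exists2 n, t <= f (c n) &
      \forall t' \near t, (f @` C) t' -> t' <= f (c n).
    have [[n tn]|nn] := pselect (exists n, t < f (c n)).
      exists n; first exact: ltW.
      near=> t' => _; apply/ltW; near: t'; exact: lt_nbhsl.
    exists (N t); first exact: NP.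
    near=> t' => /NP/le_trans; apply; apply: le_trans (NP _ It).
    by rewrite leNgt; apply/negP => tN; apply: nn; exists (N t').
  have h : polygonal f c n @ within (f @` C) (nbhs t) --> polygonal f c (N t) t.
    by rewrite (gE t n)//; apply: cvg_within_filter; exact: continuous_polygonal.
  apply: cvg_trans h; apply: near_eq_cvg.
  rewrite near_withinE; near=> t' => It'; apply/esym/gE => //.
  by move: It'; near: t'.
- by move=> t; apply: polygonal_in.
- by move=> t t0; rewrite polygonal_start ?c0E.
- by move=> t It t0; rewrite polygonalK ?c0E//; apply: NP.
Unshelve. all: by end_near.
Qed.

Lemma interval_selection (R : realType) (Z : normedModType R) (C : set Z)
    (f : {linear Z -> R^o}) : convex_set C -> C !=set0 ->
  exists g : R -> Z,
    [/\ {within f @` C, continuous g},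
        forall t, C (g t) &
        forall t, (f @` C) t -> f (g t) = t].
Proof.
move=> convC [c0 Cc0].
have [g [cg Cg g0 gK]] := half_selection f convC Cc0.
have [h [ch Ch h0 hK]] := half_selection (\- f) convC Cc0.
(* On each side of f c0 one of the two half sections is constantly c0, so that
   this sum is the other one: no gluing is needed for continuity. *)
exists (fun t => g t + h (- t) - c0); split.
- apply: within_continuousB; last exact/continuous_subspaceT/cst_continuous.
  apply: within_continuousD => //.
  apply: (within_continuousT_comp _ _ ch); first exact: opp_continuous.
  by move=> _ [_ [x Cx <-] <-]; exists x.
- move=> t; have [tc|/ltW ct] := leP t (f c0); first by rewrite g0// addrC addKr.
  by rewrite h0 ?lerN2// addrK.
- move=> t It; have [tc|/ltW ct] := leP t (f c0).
    rewrite g0// addrC addKr -[LHS]opprK; apply: (canLR opprK).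
    apply: hK; last by rewrite lerN2.
    by case: It => x Cx <-; exists x.
  by rewrite h0 ?lerN2// addrK; exact: gK.
Qed.

(** The coordinate functional of a one-dimensional Y turns L into a linear
    form, whose sections over an interval are then read along Y. *)
Lemma hereditary_invertible_line (R : realType) (Y Z : completeNormedModType R)
    (L : {linear Z -> Y}) (C : set Z) :
  has_dim 1 Y -> convex_set C -> exists s : Y -> Z,
    [/\ set_fun (L @` C) C s, {within L @` C, continuous s} &
        {in L @` C, cancel s L}].
Proof.
move=> [e [e_free e_span]] convC.
have [->|/set0P C0] := eqVneq C set0.
  exists (fun=> 0); rewrite image_set0; split=> // [|y]; last by rewrite inE.
  exact: continuous_subspace0.
have e0 : e ord0 != 0.
  apply/eqP => e0.
  have := e_free (fun=> 1); rewrite big_ord1 e0 scaler0.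
  by move=> /(_ erefl ord0)/eqP; rewrite oner_eq0.
have /choice[phi phiP] : forall y, exists r : R^o, y = r *: e ord0.
  by move=> y; have [c ->] := e_span y; exists (c ord0); rewrite big_ord1.
have eI : injective (fun r : R => r *: e ord0).
  move=> r r' /eqP; rewrite -subr_eq0 -scalerBl scaler_eq0 (negPf e0) orbF.
  by rewrite subr_eq0 => /eqP.
have phi_lin : linear phi.
  by move=> a u v; apply: eI; rewrite /= scalerDl -scalerA -!phiP.
pose phiL : {linear Y -> R^o} :=
  HB.pack phi (GRing.isLinear.Build _ _ _ _ phi phi_lin).
(* y = phi y *: e 0 makes phi a similarity of ratio 1 / |e 0|. *)
have phi_cont : continuous phi.
  have norm_phi y : `|phi y| = `|y| / `|e ord0|.
    by rewrite [in RHS](phiP y) normrZ mulfK// normr_eq0.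
  move=> y; apply/cvgrPdist_lt => eps eps0.
  have eps'0 : 0 < eps * `|e ord0| by rewrite mulr_gt0// normr_gt0.
  have /cvgrPdist_lt/(_ _ eps'0) : id @ nbhs y --> y by exact: cvg_id.
  apply: filterS => z.
  by rewrite -(linearB phiL) /= norm_phi ltr_pdivrMr ?normr_gt0.
have [g [cg Cg gK]] := interval_selection (phiL \o L) convC C0.
exists (g \o phi); split.
- by move=> y _; exact: Cg.
- apply: within_continuousT_comp phi_cont _ cg.
  by move=> _ [_ [x Cx <-] <-]; exists x.
- move=> y /set_mem[x Cx Lx]; rewrite (phiP (L _)) [RHS]phiP; congr (_ *: _).
  by apply: gK; exists x => //; rewrite -Lx.
Qed.

(** * Completeness of a product of Banach spaces *)

Section ProductComplete.
Variables (K : numFieldType) (U V : completeNormedModType K).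

(* This joins the base point of the product with its topology: limits of filters
   are stated in pointed spaces. *)
HB.instance Definition _ := Pointed.on (U * V)%type.

Lemma prod_complete (F : set_system (U * V)) :
  ProperFilter F -> cauchy F -> cvg F.
Proof.
move=> FF /cauchyP cF.
have cF1 : cauchy (fst @ F).
  apply/cauchyP => e /cF[p Fp]; exists p.1.
  have Fe : F (fst @^-1` ball p.1 e) by apply: filterS Fp => q [].
  exact: Fe.
have cF2 : cauchy (snd @ F).
  apply/cauchyP => e /cF[p Fp]; exists p.2.
  have Fe : F (snd @^-1` ball p.2 e) by apply: filterS Fp => q [].
  exact: Fe.
have /cauchy_cvg/cvg_ex[/= u Fu] := cF1.
have /cauchy_cvg/cvg_ex[/= v Fv] := cF2.
apply/cvg_ex; exists (u, v).
move=> P /(cvg_pair Fu Fv) FP.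
by have {}FP : F [set x | P (x.1, x.2)] by []; apply: filterS FP => -[].
Qed.

HB.instance Definition _ := Uniform_isComplete.Build (U * V)%type prod_complete.
End ProductComplete.

(** * A compact convex set that twists over a parabola *)

(** In coordinates p = ((x, y), l), the family of half-spaces says, on letting
    s vary, that (max x 0)^2 <= l y and (max (- x) 0)^2 <= (1 - l) y: two
    rotated quadratic cones, which force l = 1 or l = 0 where y = x^2. Written
    with half-spaces, the set is visibly closed and convex. *)
Definition twisted_wedge (R : realType) : set (R^o * R^o * R^o) :=
  [set p | [/\ -1 <= p.1.1 <= 1, 0 <= p.1.2 <= 1, 0 <= p.2 <= 1 &
    forall s, 0 <= s -> 2 * s * p.1.1 <= s ^+ 2 * p.2 + p.1.2 /\
                 - (2 * s) * p.1.1 <= s ^+ 2 * (1 - p.2) + p.1.2]].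

Section TwistedWedge.
Variable R : realType.

Lemma twisted_wedge_compact : compact (twisted_wedge (R := R)).
Proof.
pose box : set (R^o * R^o * R^o) :=
  (`[-1, 1]%classic `*` `[0, 1]%classic) `*` `[0, 1]%classic.
have cbox : compact box.
  by apply: compact_setX; [apply: compact_setX|]; exact: segment_compact.
have cfst : continuous (fun p : R^o * R^o * R^o => p.1.1 : R^o).
  by move=> p; apply: cvg_comp; exact: cvg_fst.
have cy : continuous (fun p : R^o * R^o * R^o => p.1.2 : R^o).
  by move=> p; apply: cvg_comp; [exact: cvg_fst|exact: cvg_snd].
have cl : continuous (fun p : R^o * R^o * R^o => p.2 : R^o).
  by move=> p; exact: cvg_snd.
have -> : twisted_wedge (R := R) = box `&` \bigcap_(s in [set s | 0 <= s])
  ([set p | 2 * s * p.1.1 - s ^+ 2 * p.2 - p.1.2 <= 0] `&`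
   [set p | - (2 * s) * p.1.1 - s ^+ 2 * (1 - p.2) - p.1.2 <= 0]).
  apply/seteqP; split=> [p [px py pl H]|p [[[px py] pl] H]].
    split=> [|s /H[]/=]; first by rewrite /box/= !in_itv.
    by move=> h1 h2; split=> /=; lra.
  move: px py pl; rewrite /= !in_itv/= => px py pl; split=> // s /H[/=].
  by split; lra.
apply: compact_closedI cbox _; apply: closed_bigI => s _.
apply: closedI; apply: preimage_closed (@closed_le R 0) => p _.
  apply: cvgB; last exact: cy.
  by apply: cvgB; apply: cvgMl_tmp; [exact: cfst|exact: cl].
apply: cvgB; last exact: cy.
apply: cvgB; first by apply: cvgMl_tmp; exact: cfst.
by apply: cvgMl_tmp; apply: cvgB; [exact: cvg_cst|exact: cl].
Qed.

Lemma twisted_wedge_convex : convex_set (twisted_wedge (R := R)).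
Proof.
apply/convex_set_segmentP => -[[x y] l] [[x' y'] l'] t t0 t1 /=.
case=> /= /andP[x1 x2] /andP[y1 y2] /andP[l1 l2] H.
case=> /= /andP[x1' x2'] /andP[y1' y2'] /andP[l1' l2'] H'.
(* Scaling in R^o has to be exposed as multiplication for the arithmetic. *)
split; rewrite /= /GRing.scale/=; try by apply/andP; split; nra.
move=> s /[dup] /H[h1 h2] /H'[h1' h2'].
split; nra.
Qed.

Lemma twisted_wedge_parabola (t : R) : -1 <= t <= 1 ->
  twisted_wedge (t, t ^+ 2, if 0 <= t then 1 else 0).
Proof.
move=> /[dup] t11 /andP[t1 t2]; split=> //=.
- by apply/andP; split; nra.
- by case: (0 <= t); rewrite ?lexx ?ler01.
(* The half-space facing t reduces to 0 <= (s - |t|)^2, the other one to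
   0 <= t^2 + 2 s |t|. *)
move=> s s0; have ssub_ge0 := sqr_ge0 (s - t); have sadd_ge0 := sqr_ge0 (s + t).
have t2ge0 := sqr_ge0 t.
case: (leP 0 t) => t0.
  by have st := mulr_ge0 s0 t0; split; lra.
have st : 0 <= s * - t by rewrite mulr_ge0// oppr_ge0 ltW.
by split; lra.
Qed.

(** On the parabola y = t^2, the half-space with s = |t| is tangent to the
    cone and determines l. *)
Lemma twisted_wedge_pos (t l : R) : 0 < t -> twisted_wedge (t, t ^+ 2, l) ->
  l = 1.
Proof.
move=> t0 [_ _ /andP[_ l1]] /= /(_ t (ltW t0))[h _]; apply/le_anti.
rewrite l1 -(ler_pM2l (exprn_gt0 2 t0)); lra.
Qed.

Lemma twisted_wedge_neg (t l : R) : t < 0 -> twisted_wedge (t, t ^+ 2, l) ->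
  l = 0.
Proof.
move=> t0 [_ _ /andP[l0 _]] /= /(_ (- t))[|_ h]; first by rewrite oppr_ge0 ltW.
apply/le_anti; rewrite l0 andbT.
have : 0 < t ^+ 2 by rewrite exprn_even_gt0//= lt_eqF.
nra.
Qed.
End TwistedWedge.

(** * Failure of continuous sections in dimension at least two *)

Section DimensionAtLeastTwo.
Variables (R : realType) (Y : completeNormedModType R) (e1 e2 : Y).
Hypothesis e1_neq0 : e1 != 0.
Hypothesis e2_notin : forall r : R, e2 <> r *: e1.

Lemma plane_inj (x y x' y' : R) :
  x *: e1 + y *: e2 = x' *: e1 + y' *: e2 -> x = x' /\ y = y'.
Proof.
move=> exy; have [yy'|yy'] := eqVneq y y'.
  split=> //; move: exy; rewrite yy' => /addIr/eqP.
  by rewrite -subr_eq0 -scalerBl scaler_eq0 (negPf e1_neq0) orbF subr_eq0 => /eqP.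
case: (e2_notin (r := (x' - x) / (y - y'))).
have dy : y - y' != 0 by rewrite subr_eq0.
apply: (scalerI dy); rewrite scalerA mulrC divfK// !scalerBl.
by apply/eqP; rewrite subr_eq addrAC -exy addrAC subrr add0r.
Qed.

Definition plane_embedding (p : R^o * R^o * R^o) : Y * R^o :=
  (p.1.1 *: e1 + p.1.2 *: e2, p.2).

Fact plane_embedding_is_linear : linear plane_embedding.
Proof.
move=> a [[x y] l] [[x' y'] l']; rewrite /plane_embedding /=.
congr (_, _).
rewrite /= !scalerDl !scalerDr !scalerA; exact: addrACA.
Qed.

HB.instance Definition _ :=
  GRing.isLinear.Build R (R^o * R^o * R^o)%type (Y * R^o)%type _
    plane_embedding plane_embedding_is_linear.

Lemma continuous_plane_embedding : continuous plane_embedding.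
Proof.
move=> p; have cx : (fun q : R^o * R^o * R^o => q.1.1) @ p --> (p.1.1 : R^o).
  by apply: cvg_comp; exact: cvg_fst.
have cy : (fun q : R^o * R^o * R^o => q.1.2) @ p --> (p.1.2 : R^o).
  by apply: cvg_comp; [exact: cvg_fst|exact: cvg_snd].
have cxy : (fun q : R^o * R^o * R^o => q.1.1 *: e1 + q.1.2 *: e2) @ p -->
    p.1.1 *: e1 + p.1.2 *: e2.
  apply: cvgD; (apply: cvgZ; last exact: cvg_cst); [exact: cx|exact: cy].
have cl : (fun q : R^o * R^o * R^o => q.2) @ p --> (p.2 : R^o) by exact: cvg_snd.
exact: cvg_pair cxy cl.
Qed.

(** The height of a section over the curve t e1 + t^2 e2 is continuous in t, yet
    it is 1 for t > 0 and 0 for t < 0. *)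
Lemma projection_not_hereditary :
  ~ hereditary_invertible (@compact_convex_sets R (Y * R^o)%type)
      (fst : {linear (Y * R^o)%type -> Y}).
Proof.
move=> /(_ (plane_embedding @` @twisted_wedge R))[].
  split; last exact: linear_image_convex (@twisted_wedge_convex R).
  apply: continuous_compact (@twisted_wedge_compact R).
  exact/continuous_subspaceT/continuous_plane_embedding.
move=> s [sfun scont sK].
pose D := fst @` (plane_embedding @` @twisted_wedge R).
pose q (t : R) : Y := t *: e1 + t ^+ 2 *: e2.
have qD t : -1 <= t <= 1 -> D (q t).
  move=> /twisted_wedge_parabola; set l := (if _ then _ else _) => tw.
  by exists (plane_embedding (t, t ^+ 2, l)) => //; exists (t, t ^+ 2, l).
have sq t : -1 <= t <= 1 -> twisted_wedge (t, t ^+ 2, (s (q t)).2).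
  move=> t1; have [[[x y] l] W E] := sfun _ (qD t t1).
  have := sK (q t) (mem_set (qD t t1)).
  rewrite -E /= => /plane_inj[<- <-]; exact: W.
pose g (t : R) := (s (q t)).2.
have cg : {within `[-1, 1], continuous (g : R^o -> R^o)}.
  have cs2 : {within D, continuous (snd \o s)}.
    apply: within_continuous_comp scont => z _; exact: cvg_snd.
  apply: (within_continuousT_comp _ _ cs2).
    move=> t; apply: cvgD; (apply: cvgZ; last exact: cvg_cst); first exact: cvg_id.
    exact: exprn_continuous.
  by move=> _ [t + <-]; rewrite /= in_itv/=; exact: qD.
have gpos t : 0 < t -> t <= 1 -> g t = 1.
  move=> t0 t1; apply: (twisted_wedge_pos t0); apply: sq.
  by rewrite t1 andbT ltW// (lt_trans (ltrN10 R)).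
have gneg t : t < 0 -> -1 <= t -> g t = 0.
  move=> t0 t1; apply: (twisted_wedge_neg t0); apply: sq.
  by rewrite t1/= ltW// (lt_trans t0).
have cg0 : {for 0, continuous (g : R^o -> R^o)}.
  have [+ _] := continuous_within_itvP g (lt_trans (ltrN10 R) ltr01).
  move=> /(_ cg)[+ _ _]; apply; rewrite in_itv/=.
  by rewrite ltrN10 ltr01.
have half_gt0 : 0 < 2^-1 :> R by rewrite invr_gt0.
have /cvgrPdist_lt/(_ _ half_gt0)/nbhs_ballP[d /= d0 near0] := cg0.
pose t := Num.min (d / 2) 1.
have t0 : 0 < t by rewrite lt_min ltr01 andbT divr_gt0.
have t1 : t <= 1 by rewrite ge_min lexx orbT.
have td : t < d by rewrite gt_min ltr_pdivrMr// mulr2n mulrDr mulr1 ltrDl d0.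
have : `|g 0 - g t| < 2^-1.
  by apply: near0; rewrite /ball/= sub0r normrN gtr0_norm.
have : `|g 0 - g (- t)| < 2^-1.
  by apply: near0; rewrite /ball/= sub0r opprK gtr0_norm.
have gt : g t = 1 by exact: gpos.
have gNt : g (- t) = 0 by apply: gneg; rewrite ?oppr_lt0 ?lerN2.
rewrite gt gNt !ltr_norml => /andP[_ h1] /andP[h2 _].
lra.
Qed.
End DimensionAtLeastTwo.

Theorem theorem2p1 (R : realType) (Y : completeNormedModType R)
    (Y_neq0 : exists y : Y, y != 0) :
  [<-> forall (Z : completeNormedModType R) (L : {linear Z -> Y}),
         continuous L -> set_surj [set: Z] [set: Y] L ->
         hereditary_invertible (@closed_convex_sets R Z) L;
       forall (Z : completeNormedModType R) (L : {linear Z -> Y}),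
         continuous L -> set_surj [set: Z] [set: Y] L ->
         hereditary_invertible (@compact_convex_sets R Z) L;
       has_dim 1 Y].
Proof.
tfae.
- move=> closedP Z L cL Ls C [compactC convC]; apply: closedP cL Ls _ _.
  by split=> //; apply: compact_closed compactC; exact: norm_hausdorff.
- move=> compactP; have [e1 e1_neq0] := Y_neq0.
  have span1 v : exists r : R, v = r *: e1.
    apply: contrapT => nv.
    have e2P r : v <> r *: e1 by move=> vr; apply: nv; exists r.
    apply: (projection_not_hereditary e1_neq0 e2P); apply: compactP.
      by move=> p; exact: cvg_fst.
    by move=> y _; exists (y, 0).
  exists (fun=> e1); split=> [c|v].
    rewrite big_ord1 => /eqP; rewrite scaler_eq0 (negPf e1_neq0) orbF.
    by move=> /eqP c0 i; rewrite ord1.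
  by have [r ->] := span1 v; exists (fun=> r); rewrite big_ord1.
- move=> dimY Z L _ _ C [_ convC]; exact: hereditary_invertible_line.
Qed.
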